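(* For $n\ge 1$ let $\mathcal{G}_n$ be the arrangement of hyperplanes in $V_{n-1}=\{(x_1,\dots,x_n)\in\mathbb{R}^n : x_1+\cdots+x_n=0\}$ given by $$x_i-x_j=a_i,\qquad 1\le i\le n,\ 1\le j\le n,\ i\ne j,$$ where $a_1,a_2,\dots$ are generic real numbers (e.g. linearly independent over $\mathbb{Q}$). Let $r(\mathcal{G}_n)$ be its number of regions, with the convention $r(\mathcal{G}_0)=1$, and let $$z=\sum_{n\ge 0} r(\mathcal{G}_n)\frac{x^n}{n!}=1+x+3\frac{x^2}{2!}+19\frac{x^3}{3!}+195\frac{x^4}{4!}+2831\frac{x^5}{5!}+53703\frac{x^6}{6!}+\cdots.$$ Define the power series $y=1+x+5\frac{x^2}{2!}+46\frac{x^3}{3!}+631\frac{x^4}{4!}+11586\frac{x^5}{5!}+\cdots$ by the equation $1=y\,(2-e^{xy})$. Then $z$ is the unique power series satisfying $z'/z=y^2$ and $z(0)=1$.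
   Context: A region of a finite arrangement of affine hyperplanes in a real vector space is a connected component of the complement of the union of the hyperplanes. All power series are formal power series in $x$. *)

(* Defs.v *)
From HB Require Import structures.
From mathcomp Require Import all_boot all_order all_algebra.
From mathcomp Require Import finmap.
From mathcomp Require Import all_classical all_reals all_analysis.

Set Implicit Arguments.
Unset Strict Implicit.
Unset Printing Implicit Defensive.

Import Order.TTheory GRing.Theory Num.Theory.
Import numFieldNormedType.Exports.

Local Open Scope classical_set_scope.
Local Open Scope ring_scope.

(* Formal power series are coefficient sequences; the product is the Cauchy
   product, not the pointwise one. *)
Section PowerSeries.
Context {K : fieldType}.

Definition fps : Type := nat -> K.

Implicit Types f g : fps.

Definition fps_const (c : K) : fps := fun n => if n is 0 then c else 0.
Definition fps_X : fps := fun n => (n == 1%N)%:R.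
Definition fps_sub f g : fps := fun n => f n - g n.
Definition fps_mul f g : fps := fun n => \sum_(i < n.+1) f i * g (n - i)%N.
Definition fps_pow f (k : nat) : fps := iter k (fps_mul f) (fps_const 1).
Definition fps_deriv f : fps := fun n => n.+1%:R * f n.+1.

(* The series e^f = \sum_k f^k / k!, for f with zero constant term: then f^k
   has no term of degree < k, so that only k <= n contribute in degree n. *)
Definition fps_exp f : fps :=
  fun n => \sum_(k < n.+1) fps_pow f k n / (k`!)%:R.

(* The first n coefficients of 1 / f, when f has nonzero constant term. *)
Fixpoint fps_inv_seq f (n : nat) : seq K :=
  if n is m.+1 then
    let s := fps_inv_seq f m in
    rcons s ((f 0%N)^-1 * ((m == 0%N)%:R - \sum_(i < m) s`_i * f (m - i)%N))
  else [::].
Definition fps_inv f : fps := fun n => (fps_inv_seq f n.+1)`_n.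
Definition fps_div f g : fps := fps_mul f (fps_inv g).

Lemma size_fps_inv_seq f n : size (fps_inv_seq f n) = n.
Proof. by elim: n => //= n IHn; rewrite size_rcons IHn. Qed.

Lemma nth_fps_inv_seq f n i : (i < n)%N -> (fps_inv_seq f n)`_i = fps_inv f i.
Proof.
elim: n => // n IHn; rewrite ltnS leq_eqVlt => /predU1P[-> //|lt_in].
by rewrite /= nth_rcons size_fps_inv_seq lt_in IHn.
Qed.

Lemma fps_mulVf f : f 0%N != 0 -> fps_mul (fps_inv f) f = fps_const 1.
Proof.
move=> f0; apply/funext => n; rewrite /fps_mul big_ord_recr /= subnn.
rewrite {2}/fps_inv /= nth_rcons size_fps_inv_seq ltnn eqxx.
rewrite [_^-1 * _]mulrC mulfVK //.
under [X in _ + (_ - X)]eq_bigr => i _ do rewrite nth_fps_inv_seq //.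
by rewrite addrC subrK; case: n.
Qed.

End PowerSeries.

Arguments fps : clear implicits.

Section Arrangements.
Context {R : realType}.

(* Arrangements inside a subset V of R^n (here, a linear subspace). *)
Definition arrangement_complement n (V : set 'rV[R]_n)
    (A : set (set 'rV[R]_n)) : set 'rV[R]_n :=
  V `\` \bigcup_(H in A) H.

Definition regions n (V : set 'rV[R]_n) (A : set (set 'rV[R]_n)) :
    set (set 'rV[R]_n) :=
  connected_component (arrangement_complement V A)
    @` arrangement_complement V A.

Definition Vsum0 n : set 'rV[R]_n := [set x | \sum_(i < n) x 0 i = 0].
Arguments Vsum0 n : clear implicits.

(* Indices start at 0: [a i] is the parameter a_{i+1}. *)
Definition Ghyperplane (a : nat -> R) n (i j : 'I_n) : set 'rV[R]_n :=
  [set x | Vsum0 n x /\ x 0 i - x 0 j = a i].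

Definition Garrangement (a : nat -> R) n : set (set 'rV[R]_n) :=
  [set H | exists i j : 'I_n, i != j /\ H = Ghyperplane a i j].
Arguments Garrangement a n : clear implicits.

Definition num_regions_G (a : nat -> R) (n : nat) : nat :=
  if n is 0 then 1%N else #|` fset_set (regions (Vsum0 n) (Garrangement a n))|.

Definition zseries (a : nat -> R) : fps R :=
  fun n => (num_regions_G a n)%:R / (n`!)%:R.

(* For each family S of hyperplanes of G_n, the parameters for which S has a
   common point form a linear subspace of R^n.  Being generic means avoiding
   the proper ones among these finitely many subspaces: S has a common point
   only if it has one for every choice of the parameters. *)
Definition generic (a : nat -> R) : Prop :=
  forall (n : nat) (S : {set 'I_n * 'I_n}),
    (forall p, p \in S -> p.1 != p.2) ->
    \bigcap_(p in [set` S]) Ghyperplane a p.1 p.2 !=set0 ->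
    forall b : nat -> R, \bigcap_(p in [set` S]) Ghyperplane b p.1 p.2 !=set0.

Definition lin_indep_rat (a : nat -> R) : Prop :=
  forall (n : nat) (c : 'I_n -> rat),
    \sum_(i < n) ratr (c i) * a i = 0 -> forall i, c i = 0.

Lemma lin_indep_rat_generic a : lin_indep_rat a -> generic a.
Proof.
move=> ha n S _ [x Sx] b.
pose M : 'M[rat]_(n, #|S|) :=
  \matrix_(i, k) ((i == (enum_val k).1)%:R - (i == (enum_val k).2)%:R).
pose P : 'M[rat]_(n, #|S|) := \matrix_(i, k) (i == (enum_val k).1)%:R.
pose f := map_mx (ratr : rat -> R).
have sumE (y : 'rV[R]_n) (l : 'I_n) : \sum_i y 0 i * ratr (i == l)%:R = y 0 l.
  rewrite (bigD1 l) //= eqxx rmorph1 mulr1 big1 ?addr0 // => i /negbTE ->.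
  by rewrite rmorph0 mulr0.
have ME (y : 'rV[R]_n) k :
    (y *m f _ _ M) 0 k = y 0 (enum_val k).1 - y 0 (enum_val k).2.
  rewrite -!sumE -sumrB mxE; apply: eq_bigr => i _.
  by rewrite !mxE rmorphB mulrBr.
have PE (y : 'rV[R]_n) k : (y *m f _ _ P) 0 k = y 0 (enum_val k).1.
  by rewrite -sumE mxE; apply: eq_bigr => i _; rewrite !mxE.
pose av (c : nat -> R) : 'rV[R]_n := \row_i c i.
have eqa : x *m f _ _ M = av a *m f _ _ P.
  apply/rowP => k; rewrite ME PE mxE.
  by have [] := Sx (enum_val k) (enum_valP k).
have PK0 : P *m cokermx M = 0.
  apply/matrixP => i k; rewrite [RHS]mxE.
  apply: (ha n (fun i => (P *m cokermx M) i k)).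
  transitivity ((av a *m f _ _ (P *m cokermx M)) 0 k).
    by rewrite [RHS]mxE; apply: eq_bigr => j _; rewrite !mxE mulrC.
  rewrite /f map_mxM mulmxA -/(f _ _ P) -eqa -mulmxA -map_mxM mulmx_coker.
  by rewrite map_mx0 mulmx0 mxE.
have /submxP[y eqb] : (av b *m f _ _ P <= f _ _ M)%MS.
  rewrite submxE -map_cokermx -mulmxA -map_mxM PK0.
  by rewrite map_mx0 mulmx0.
pose m := (\sum_i y 0 i) / n%:R.
exists (\row_i (y 0 i - m)) => p Sp; split.
  rewrite /Vsum0 /=; under eq_bigr do rewrite mxE.
  rewrite sumrB sumr_const card_ord -mulr_natr /m divfK ?subrr //.
  by rewrite pnatr_eq0 -lt0n (leq_trans _ (ltn_ord p.1)).
have := congr1 (fun u : 'rV[R]_#|S| => u 0 (enum_rank_in Sp p)) eqb.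
rewrite ME PE mxE enum_rankK_in //= => ->; rewrite !mxE.
by rewrite opprB addrA subrK.
Qed.

End Arrangements.

(* Main.v *)
(* Picture variable i as a rod on the line with ends x_i and y_i = x_i - a_i:
   a region of G_n records, for i <> j, on which side of x_j the end y_i lies.
   More generally let k fixed points be given, some repelling only the y-ends
   and the others only the x-ends, in generic position, together with m free
   rods, and let F(k, m) be the number of regions of this arrangement.
   Remove a fixed point c by deletion-restriction along the m hyperplanes on
   which one of the rods touches c.  These are independent, so the regions are
   counted by summing over the sets S of rods touching c.  If S is nonempty, c
     acts on the
   other rods like a fixed point of the other type, and the other ends of the
   rods in S are |S| new generic fixed points.  Hence
     F(k+1, m) = F(k, m) + \sum_(s >= 1) C(m, s) F(k+s+1, m-s),
   and pinning one rod gives F(0, m+1) = F(2, m).  The equation of y reads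
   y = 1 + y (e^(xy) - 1), so m! [x^m] (z y^k) satisfies the first recursion,
   and z' = z y^2 is the second one. *)
Require Import Defs.
From HB Require Import structures.
From mathcomp Require Import all_boot all_order all_algebra.
From mathcomp Require Import finmap.
From mathcomp Require Import all_classical all_reals all_analysis.
From mathcomp Require Import ring lra zify.

Set Implicit Arguments.
Unset Strict Implicit.
Unset Printing Implicit Defensive.

Import Order.TTheory GRing.Theory Num.Theory.
Import numFieldNormedType.Exports.

Local Open Scope classical_set_scope.
Local Open Scope ring_scope.

(** * Cells of an arrangement *)

Section Cells.
Context {R : realType}.
Implicit Types (T : Type).

(** Sign cells stand in for regions: no topology enters, so they can be counted by recursion on the
    list. The bridge to connected components is [card_components]. *)
Fixpoint cells T (D : set T) (L : seq (T -> R)) : seq (set T) :=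
  if L is f :: L' then
    cells (D `&` [set x | 0 < f x]) L' ++ cells (D `&` [set x | f x < 0]) L'
  else if `[< D !=set0 >] then [:: D] else [::].

Definition ncells T (D : set T) (L : seq (T -> R)) : nat := size (cells D L).

Definition same_side T (L : seq (T -> R)) (x y : T) : Prop :=
  forall f, f \in L -> 0 < f x * f y.

Lemma same_side_nil T (x y : T) : same_side [::] x y.
Proof. by []. Qed.

Lemma same_side_cons T (f : T -> R) L x y :
  same_side (f :: L) x y <-> 0 < f x * f y /\ same_side L x y.
Proof.
split=> [xy|[fxy xy] g]; first split; first by apply: xy; rewrite mem_head.
  by move=> g gL; apply: xy; rewrite inE gL orbT.
by rewrite inE => /predU1P[->|/xy].
Qed.

Lemma same_side_cat T (L1 L2 : seq (T -> R)) x y :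
  same_side (L1 ++ L2) x y <-> same_side L1 x y /\ same_side L2 x y.
Proof.
split=> [xy|[xy1 xy2] g]; last by rewrite mem_cat => /orP[/xy1|/xy2].
by split=> g gL; apply: xy; rewrite mem_cat gL ?orbT.
Qed.

Lemma same_side_allpairs T (I J : eqType) (F : I -> J -> T -> R) s t x y :
  same_side [seq F i j | i <- s, j <- t] x y <->
  forall i j, i \in s -> j \in t -> 0 < F i j x * F i j y.
Proof.
split=> [xy i j si tj|xy g /allpairsP[[i j] [/= si tj ->]]]; last exact: xy.
by apply: xy; apply/allpairsP; exists (i, j).
Qed.

Lemma ncells_cons T (D : set T) f L :
  ncells D (f :: L) = (ncells (D `&` [set x | 0%R < f x]%R) L +
    ncells (D `&` [set x | f x < 0]%R) L)%N.
Proof. by rewrite /ncells size_cat. Qed.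

Lemma ncells_nil T (D : set T) : ncells D [::] = `[< D !=set0 >].
Proof. by rewrite /ncells /=; case: asboolP. Qed.

Lemma ncells0 T (L : seq (T -> R)) : ncells set0 L = 0%N.
Proof.
elim: L => [|f L IHL]; last by rewrite ncells_cons !set0I IHL.
by rewrite ncells_nil asboolF // => -[].
Qed.

Lemma ncells_insert T (D : set T) L1 f L2 :
  ncells D (L1 ++ f :: L2) = ncells D (f :: L1 ++ L2).
Proof.
elim: L1 D => // g L1 IHL D; rewrite cat_cons !ncells_cons !IHL !ncells_cons.
rewrite ![D `&` [set x | is_true (0 < f x)] `&` _]setIAC.
by rewrite ![D `&` [set x | is_true (f x < 0)] `&` _]setIAC addnACA.
Qed.

Lemma ncells_catC T (D : set T) L1 L2 :
  ncells D (L1 ++ L2) = ncells D (L2 ++ L1).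
Proof.
elim: L2 L1 D => [|f L2 IHL] L1 D; first by rewrite cats0.
by rewrite ncells_insert cat_cons !ncells_cons !IHL.
Qed.

(** On a cell of [L1] each function of [L2] has a constant sign, and taking [x = y] in the
    hypothesis shows that it vanishes nowhere there. Splitting by it only adds an empty piece. *)
Lemma ncells_determined T (D : set T) L1 L2 :
  (forall x y, D x -> D y -> same_side L1 x y -> same_side L2 x y) ->
  ncells D (L1 ++ L2) = ncells D L1.
Proof.
elim: L1 D => [|f L1 IHL] D L12; last first.
  rewrite cat_cons !ncells_cons !IHL // => x y [Dx /= fx] [Dy /= fy] xy;
    by apply: L12 => //; apply/same_side_cons; split=> //; nra.
have [->|D0] := eqVneq D set0; first by rewrite !ncells0.
have {L12} /= L2D x y Dx Dy := L12 x y Dx Dy (@same_side_nil _ _ _).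
have {D0} [x Dx] : D !=set0 by apply/set0P.
elim: L2 L2D => [|f L2 IHL] L2D //=.
have {}IHL : ncells D L2 = ncells D [::].
  by apply: IHL => // y z Dy Dz; case/same_side_cons: (L2D y z Dy Dz).
have fD y (Dy : D y) : 0 < f x * f y.
  by case/same_side_cons: (L2D x y Dx Dy).
rewrite ncells_cons -{}IHL; case: (ltrgt0P (f x)) => fx.
- rewrite (_ : D `&` [set y | 0 < f y]%R = D); last first.
    by apply/seteqP; split=> [y []|y Dy] //; split=> //=; have := fD y Dy; nra.
  rewrite (_ : D `&` _ = set0) ?ncells0 ?addn0 //.
  by apply/seteqP; split=> // y [Dy /= fy]; have := fD y Dy; nra.
- rewrite (_ : D `&` [set y | f y < 0]%R = D); last first.
    by apply/seteqP; split=> [y []|y Dy] //; split=> //=; have := fD y Dy; nra.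
  rewrite (_ : D `&` _ = set0) ?ncells0 ?addn0 //.
  by apply/seteqP; split=> // y [Dy /= fy]; have := fD y Dy; nra.
- by have := fD x Dx; rewrite fx mul0r ltxx.
Qed.

(** Each list determines the other, so both counts equal that of the concatenation. *)
Lemma eq_ncells T (D : set T) L1 L2 :
  (forall x y, D x -> D y -> same_side L1 x y <-> same_side L2 x y) ->
  ncells D L1 = ncells D L2.
Proof.
move=> L12; rewrite -(@ncells_determined _ D L1 L2) => [|x y Dx Dy]; last first.
  by apply: (L12 x y Dx Dy).1.
rewrite ncells_catC ncells_determined // => x y Dx Dy.
by apply: (L12 x y Dx Dy).2.
Qed.

(** The map [phi] need not be onto: it suffices that the values of the functions in [L] are attained
    together. This allows a change of ambient space. *)
Lemma ncells_comp T T' (phi : T -> T') (D : set T) (D' : set T')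
    (L : seq (T' -> R)) :
  (forall x, D x -> D' (phi x)) ->
  (forall x', D' x' ->
    exists2 x, D x & forall f, f \in L -> f (phi x) = f x') ->
  ncells D [seq f \o phi | f <- L] = ncells D' L.
Proof.
elim: L D D' => [|f L IHL] D D' phiD D'phi.
  rewrite /= !ncells_nil; congr (nat_of_bool _); apply: asbool_equiv_eq; split.
    by move=> [x Dx]; exists (phi x); apply: phiD.
  by move=> [x' /D'phi[x Dx _]]; exists x.
rewrite /= !ncells_cons; congr (_ + _)%N; apply: IHL => [x [Dx /= fx]|].
- by split; first exact: phiD.
- move=> x' [/D'phi[x Dx fx] /= fx']; exists x => [|g gL].
    by split=> //=; rewrite fx ?mem_head.
  by rewrite fx // inE gL orbT.
- by split; first exact: phiD.
- move=> x' [/D'phi[x Dx fx] /= fx']; exists x => [|g gL].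
    by split=> //=; rewrite fx ?mem_head.
  by rewrite fx // inE gL orbT.
Qed.

(** * Deletion-restriction for affine functions *)

Section CellGeometry.
Context {V : lmodType R}.
Implicit Types (D : set V) (f : V -> R) (L : seq (V -> R)).

Definition affine_fun f : Prop :=
  forall x y t, f ((1 - t) *: x + t *: y) = (1 - t) * f x + t * f y.

Definition convex_set D : Prop :=
  forall x y t, D x -> D y -> 0 <= t <= 1 -> D ((1 - t) *: x + t *: y).

(** Openness is asked in one direction only: points will have infinitely many coordinates, and only
    a step transversal to the deleted hyperplane is made. *)
Definition open_along (e : V) D : Prop :=
  forall x, D x -> exists2 d, 0 < d & forall t, `|t| < d -> D (x + t *: e).

Lemma affine_fun_line f x e t :
  affine_fun f -> f (x + t *: e) = f x + t * (f (x + e) - f x).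
Proof.
move=> fA; have := fA x (x + e) t.
rewrite scalerDr addrA -scalerDl subrK scale1r => ->; ring.
Qed.

Lemma convex_set_lt f D (s : bool) : affine_fun f -> convex_set D ->
  convex_set (D `&` [set x | 0 < (-1) ^+ s * f x]).
Proof.
move=> fA DC x y t [Dx /= fx] [Dy /= fy] t01; split; first exact: DC.
by rewrite /= fA; move: t01 fx fy; case: s => /andP[? ?];
  rewrite ?expr0 ?expr1; nra.
Qed.

Lemma open_along_lt f e D (s : bool) : affine_fun f -> open_along e D ->
  open_along e (D `&` [set x | 0 < (-1) ^+ s * f x]).
Proof.
move=> fA De x [/De[d d0 Dd] /= fx].
set v := (-1) ^+ s * f x in fx; set k := `|f (x + e) - f x| + 1.
have k0 : 0 < k by rewrite ltr_wpDl.
exists (Num.min d (v / k)) => [|t]; first by rewrite lt_min d0 divr_gt0.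
rewrite lt_min ltr_pdivlMr // => /andP[td tv]; split; first exact: Dd.
rewrite /= affine_fun_line // mulrDr -/v.
have : `|(-1) ^+ s * (t * (f (x + e) - f x))| < v.
  rewrite normrM normrX normrN1 expr1n mul1r normrM.
  by apply: le_lt_trans tv; rewrite ler_wpM2l // lerDl.
by rewrite ltr_norml => /andP[]; lra.
Qed.

Lemma set_pos_lt f (s : bool) : [set x | 0 < (-1) ^+ s * f x] =
  if s then [set x | f x < 0] else [set x | 0 < f x].
Proof.
case: s; apply/seteqP; split=> x /=;
  by rewrite ?expr0 ?expr1 ?mul1r ?mulN1r ?oppr_gt0.
Qed.

(** A cell is cut in two exactly when it meets the zero set of [f]: by convexity, points on opposite
    sides have a zero between them; by openness along [e], a zero has points of the cell on both
    sides. *)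
Lemma ncells_restrict f e D L : affine_fun f ->
  (forall x t, f (x + t *: e) = f x + t) ->
  (forall g, g \in L -> affine_fun g) ->
  convex_set D -> open_along e D ->
  ncells D (f :: L) = (ncells D L + ncells (D `&` [set x | f x = 0%R]) L)%N.
Proof.
move=> fA fe; rewrite ncells_cons; elim: L D => [|g L IHL] D LA DC De.
  rewrite !ncells_nil; have [[x Dx]|D0] := pselect (D !=set0); last first.
    have D0' X : `[< D `&` X !=set0 >] = false.
      by apply: asboolF => -[x [Dx _]]; apply: D0; exists x.
    by rewrite !D0' asboolF.
  rewrite (asboolT (P := D !=set0)); last by exists x.
  have [[z [Dz /= fz]]|f0] := pselect (D `&` [set x | f x = 0] !=set0).
    have [d d0 Dd] := De z Dz.
    rewrite !asboolT //; first by exists z.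
      exists (z + (- (d / 2)) *: e); split=> /=; last by rewrite fe fz; lra.
      by apply: Dd; rewrite normrN ger0_norm; lra.
    exists (z + (d / 2) *: e); split=> /=; last by rewrite fe fz; lra.
    by apply: Dd; rewrite ger0_norm; lra.
  rewrite [X in (_ = _ + nat_of_bool X)%N]asboolF // addn0.
  case: (ltrgt0P (f x)) => fx.
  - rewrite asboolT; last by exists x.
    rewrite asboolF // => -[y [Dy /= fy]]; apply: f0.
    have k0 : f x - f y != 0 by lra.
    (* The zero of [f] on the segment from [x] to [y]. *)
    exists ((1 - f x / (f x - f y)) *: x + (f x / (f x - f y)) *: y); split.
      apply: DC => //; rewrite divr_ge0 /= ?ler_pdivrMr; lra.
    by rewrite /= fA; field.
  - rewrite addnC asboolT; last by exists x.
    rewrite asboolF // => -[y [Dy /= fy]]; apply: f0.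
    have k0 : f y - f x != 0 by lra.
    exists ((1 - (- f x) / (f y - f x)) *: x + ((- f x) / (f y - f x)) *: y);
      split.
      apply: DC => //; rewrite divr_ge0 /= ?ler_pdivrMr; lra.
    by rewrite /= fA; field.
  - by case: f0; exists x.
rewrite !ncells_cons addnACA.
have gA : affine_fun g by apply: LA; rewrite mem_head.
have LA' h : h \in L -> affine_fun h by move=> hL; apply: LA;
  rewrite inE hL orbT.
have IHs (s : bool) : (let D' := D `&` [set x | 0 < (-1) ^+ s * g x]%R in
  ncells (D' `&` [set x | 0%R < f x]%R) L + ncells (D' `&` [set x | f x < 0]%R)
    L
  = ncells D' L + ncells (D' `&` [set x | f x = 0%R]) L)%N.
  by apply: IHL => //; [apply: convex_set_lt|apply: open_along_lt].
have := IHs false; have := IHs true; rewrite !set_pos_lt /= => IH1 IH0.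
rewrite ![D `&` [set x | is_true (0 < f x)] `&` _]setIAC.
rewrite ![D `&` [set x | is_true (f x < 0)] `&` _]setIAC.
rewrite ![D `&` [set x | f x = 0] `&` _]setIAC.
by rewrite IH0 IH1 addnACA.
Qed.

End CellGeometry.
End Cells.

(** * Rods and fixed points *)

Section PinSums.
Context {R : realType} {V : lmodType R}.

(** Deletion-restriction along every [f i] produces one flat per subset of [M]. The directions [e]
    are dual to the [f i], so each flat stays open along the directions of the remaining indices. *)
Lemma ncells_pins (f : nat -> V -> R) (e : nat -> V) L (h : nat -> nat) M D :
  uniq M ->
  (forall i, affine_fun (f i)) ->
  (forall i j x t, f i (x + t *: e j) = f i x + (i == j)%:R * t) ->
  (forall g, g \in L -> affine_fun g) ->
  convex_set D -> (forall i, i \in M -> open_along (e i) D) ->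
  (forall S, subseq S M ->
    ncells (D `&` [set x | forall i, i \in S -> f i x = 0%R]) L = h (size S)) ->
  ncells D ([seq f i | i <- M] ++ L) =
    (\sum_(s < (size M).+1) 'C(size M, s) * h s)%N.
Proof.
move=> + fA fe LA; elim: M D h => [|i M IHM] D h /=.
  move=> _ _ _ /(_ [::] isT); rewrite big_ord1 mul1n => <-; congr ncells.
  by apply/seteqP; split=> [x Dx|x []].
move=> /andP[iM uM] DC De DS; rewrite (@ncells_restrict _ _ (f i) (e i)) //.
(* Here [S] is the successor: a flat inside [f i = 0] has one more index. The two sums combine by
   Pascal's rule. *)
- rewrite (IHM D h) ?(IHM _ (h \o S)) //.
  + rewrite [RHS]big_ord_recl bin0;
      under [in RHS]eq_bigr do rewrite binS mulnDl.
    rewrite big_split /= addnA; congr (_ + _)%N.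
    by rewrite [RHS]addnC -[LHS]addn0 [in RHS]big_ord_recr /= bin_small
      ?mul0n ?addn0 // [LHS]big_ord_recl bin0 addnC.
  + move=> x y t [Dx /= fx] [Dy /= fy] t01; split; first exact: DC.
    by rewrite /= fA fx fy !mulr0 addr0.
  + move=> j jM x [Dx /= fx].
    have [|d d0 Dd] := De j _ x Dx; first by rewrite inE jM orbT.
    exists d => // t td; split; first exact: Dd.
    by rewrite /= fe fx; case: eqVneq jM iM => [->->//|_]; rewrite mul0r addr0.
  + move=> T sTM; rewrite /= -(DS (i :: T)) /= ?eqxx //.
    congr ncells; rewrite -setIA; congr (_ `&` _); apply/seteqP.
    split=> [x [/= fx fT] j|x fT]; first by rewrite inE => /predU1P[->|/fT].
    split=> [|j jT]; first by apply: fT; rewrite mem_head.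
    by apply: fT; rewrite inE jT orbT.
  + by move=> j jM; apply: De; rewrite inE jM orbT.
  + move=> T sTM; exact: DS (subseq_trans sTM (subseq_cons M i)).
- by move=> x t; rewrite fe eqxx mul1r.
- by move=> g; rewrite mem_cat => /orP[/mapP[j _ ->]|/LA].
- by apply: De; rewrite mem_head.
Qed.

End PinSums.

Section Rods.
Context {R : realType} (a : nat -> R).

(** Every rod keeps its coordinate, so that removing rods does not change the space; only the
    coordinates in [M] matter, by [obstacles_ext]. *)
Local Notation point := (nat -> R^o).
Implicit Types (i j n : nat) (M S : seq nat) (t : bool) (P : seq (bool * R)) (x
  y : point).

(* [true] stands for the end x_i of the rod i, [false] for its end x_i - a_i.
   A fixed point [(t, c)] is at [c] and repels the rod ends of type [~~ t]. *)
Definition rod_end (t : bool) (i : nat) (x : point) : R :=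
  if t then x i else x i - a i.

Definition rod_shift (t : bool) (i : nat) : R := if t then a i else - a i.

Definition rod_gap (i j : nat) (x : point) : R :=
  rod_end false i x - rod_end true j x.

Definition pin_gap (p : bool * R) (i : nat) (x : point) : R :=
  rod_end (~~ p.1) i x - p.2.

(* The pairs (i, i) are included: they give the nonzero constants [- a i]. *)
Definition obstacles (P : seq (bool * R)) (M : seq nat) : seq (point -> R) :=
  [seq rod_gap i j | i <- M, j <- M] ++ [seq pin_gap p i | p <- P, i <- M].

Lemma rod_endE t i x : rod_end t i x = rod_end (~~ t) i x + rod_shift t i.
Proof. by rewrite /rod_end /rod_shift; case: t => /=; ring. Qed.

Lemma rod_shiftE t i : rod_shift t i = (-1) ^+ (~~ t) * a i.
Proof. by rewrite /rod_shift; case: t => /=; rewrite ?expr0 ?expr1; ring. Qed.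

Lemma rod_gapE t i j x :
  rod_end (~~ t) i x - rod_end t j x = if t then rod_gap i j x else - rod_gap j
    i x.
Proof. by rewrite /rod_gap; case: t => /=; ring. Qed.

Lemma affine_rod_end t i : affine_fun (rod_end t i).
Proof. by move=> x y u; rewrite /rod_end !fctE; case: t;
  rewrite /GRing.scale /=; ring. Qed.

Lemma affine_rod_gap i j : affine_fun (rod_gap i j).
Proof. by move=> x y u; rewrite /rod_gap !affine_rod_end; ring. Qed.

Lemma affine_pin_gap p i : affine_fun (pin_gap p i).
Proof. by move=> x y u; rewrite /pin_gap !affine_rod_end; ring. Qed.

Lemma affine_obstacles P M g : g \in obstacles P M -> affine_fun g.
Proof.
rewrite mem_cat => /orP[]/allpairsP[[i j] [_ _ ->]].
  exact: affine_rod_gap.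
exact: affine_pin_gap.
Qed.

Lemma same_side_obstacles P M x y : same_side (obstacles P M) x y <->
  (forall i j, i \in M -> j \in M -> 0 < rod_gap i j x * rod_gap i j y) /\
  (forall p i, p \in P -> i \in M -> 0 < pin_gap p i x * pin_gap p i y).
Proof. by rewrite /obstacles same_side_cat !same_side_allpairs. Qed.

Definition unit_point (j : nat) : point := fun i => (i == j)%:R.

Lemma rod_end_unit t i j x u :
  rod_end t i (x + u *: unit_point j) = rod_end t i x + (i == j)%:R * u.
Proof.
by rewrite /rod_end /unit_point !fctE /GRing.scale /=; case: t; ring.
Qed.

Section Generic.
Variable n : nat.

Definition signs (e : nat -> R) := forall i, e i \in [:: -1; 0; 1].

Hypothesis a_generic : forall e, signs e ->
  \sum_(i < n) e i * a i = 0 -> forall i, (i < n)%N -> e i = 0.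

Definition signed_sum (M : seq nat) (d : R) : Prop :=
  exists e, [/\ signs e, forall i, i \notin M -> e i = 0 &
    d = \sum_(i < n) e i * a i].

Lemma signed_sum0 M : signed_sum M 0.
Proof.
exists (fun=> 0); split=> // [i|]; first by rewrite !inE eqxx orbT.
by rewrite big1 // => i _; rewrite mul0r.
Qed.

Lemma signed_sumS M M' d :
  {subset M <= M'} -> signed_sum M d -> signed_sum M' d.
Proof.
move=> sMM' [e [es eM de]]; exists e; split=> // i iM'; apply: eM.
by apply: contra iM' => /sMM'.
Qed.

Lemma signed_sumD M d t i : (i < n)%N -> i \notin M -> signed_sum M d ->
  signed_sum (i :: M) (d + rod_shift t i).
Proof.
move=> lt_in iM [e [es eM ->]].
exists (fun j => if j == i then (-1) ^+ (~~ t) else e j); split=> [j|j|].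
- by case: eqP => _ //; case: (t); rewrite /= !inE ?expr0 ?expr1 eqxx ?orbT.
- by rewrite inE negb_or => /andP[/negbTE-> /eM].
rewrite (bigD1 (Ordinal lt_in)) // [in RHS](bigD1 (Ordinal lt_in)) //= eqxx eM
  //.
rewrite mul0r add0r addrC; congr (_ + _); last exact: rod_shiftE.
by apply: eq_bigr => j; rewrite -val_eqE /= => /negbTE->.
Qed.

(** As [i] is not in [M], the sum has coefficient 1 or -1 at [a i], so genericity forbids it to
    vanish. *)
Lemma signed_sum_shift M d t i : (i < n)%N -> i \notin M -> signed_sum M d ->
  d + rod_shift t i != 0.
Proof.
move=> lt_in iM [e [es eM ->]]; apply/eqP => s0.
suff [e' [e's e'i]] : exists e', [/\ signs e', e' i != 0 &
    \sum_(i < n) e' i * a i = 0].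
  by move=> /(a_generic e's)/(_ i lt_in)/eqP; apply/negP.
exists (fun j => if j == i then (-1) ^+ (~~ t) else e j); split=> [j||].
- by case: eqP => _ //; case: (t); rewrite /= !inE ?expr0 ?expr1 eqxx ?orbT.
- by rewrite eqxx signr_eq0.
rewrite -[RHS]s0.
rewrite (bigD1 (Ordinal lt_in)) // [in RHS](bigD1 (Ordinal lt_in)) //= eqxx eM
  //.
rewrite mul0r add0r addrC; congr (_ + _); last first.
  exact/esym/rod_shiftE.
by apply: eq_bigr => j; rewrite -val_eqE /= => /negbTE->.
Qed.

(** Generic position of the fixed points relative to the free rods, the invariant of the recursion.
    As 0 is a signed sum, the positions are in particular distinct. *)
Definition pins_apart (P : seq (bool * R)) (M : seq nat) : bool :=
  pairwise (fun p q => `[< ~ signed_sum M (p.2 - q.2) >]) P.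

Definition pinned (t : bool) (c : R) (S : seq nat) : set point :=
  [set x | forall i, i \in S -> rod_end (~~ t) i x = c].

Definition pins_after (t : bool) (c : R) (S : seq nat) P : seq (bool * R) :=
  [seq (t, c + rod_shift t i) | i <- S] ++ (~~ t, c) :: P.

Lemma pins_apartS P M M' : {subset M' <= M} ->
  pins_apart P M -> pins_apart P M'.
Proof.
move=> sM'M; apply: sub_pairwise => p q /asboolP pq.
by apply/asboolP => /(signed_sumS sM'M).
Qed.

Lemma pins_apart_after t c S P M M' :
  uniq S -> {subset S <= M} -> {subset M' <= M} ->
  (forall i, i \in S -> (i < n)%N /\ i \notin M') ->
  pins_apart ((t, c) :: P) M -> pins_apart (pins_after t c S P) M'.
Proof.
move=> uS sSM sM'M SM' cPM.
rewrite /pins_apart pairwise_cat; apply/and3P; split.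
(* A new fixed point differs from [c] by [a i] up to sign. If its difference with an old [q] were a
   signed sum over [M'], moving [a i] across would make [c - q.2] a signed sum over [M]. *)
- apply/allrelP => p q /mapP[i iS ->]; have [lt_in iM'] := SM' i iS.
  rewrite inE => /predU1P[->|qP]; apply/asboolP => /= ci.
    apply: (negP (signed_sum_shift (~~ t) lt_in iM' ci)); apply/eqP.
    by rewrite /rod_shift; case: t {cPM ci} => /=; ring.
  move: cPM => /andP[/allP/(_ q qP)/asboolP cq _]; apply: cq.
  have := signed_sumD (~~ t) lt_in iM' ci.
  rewrite (_ : _ + _ = c - q.2); last by rewrite /rod_shift; case: (t) => /=;
    ring.
  by apply: signed_sumS => j; rewrite inE => /predU1P[->|/sM'M //]; apply: sSM.
(* Two new fixed points differ by [a i - a j] up to sign, with distinct [i] and [j] outside [M']. *)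
- rewrite pairwise_map; move: uS; rewrite uniq_pairwise.
  apply: sub_in_pairwise (allss S) => i j iS jS /= ij.
  have [[lt_in iM'] [lt_jn jM']] := (SM' i iS, SM' j jS).
  apply/asboolP => /(signed_sumD (~~ t) lt_in iM') cij.
  have ji : j != i by rewrite eq_sym.
  have jiM' : j \notin i :: M' by rewrite inE negb_or ji.
  apply: (negP (signed_sum_shift t lt_jn jiM' cij)); apply/eqP.
  by rewrite /rod_shift; case: (t) => /=; ring.
- exact: (pins_apartS sM'M cPM).
Qed.

(** The rods of [S] are immobile on the flat. Their gaps to a rod outside [S] become its gaps to
    fixed points; their gaps to each other and to [P] are constants, nonzero by genericity, and
    impose no condition. *)
Lemma same_side_pinned t c S P M x y :
  (0 < size S)%N -> uniq S -> {subset S <= M} ->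
  (forall i, i \in M -> (i < n)%N) ->
  pins_apart ((t, c) :: P) M -> pinned t c S x -> pinned t c S y ->
  same_side (obstacles P M) x y <->
  same_side (obstacles (pins_after t c S P) [seq i <- M | i \notin S]) x y.
Proof.
move=> S0 uS sSM Mn cPM Sx Sy; rewrite !same_side_obstacles.
have sq0 (u : R) : u != 0 -> 0 < u * u by rewrite -expr2 => u0;
  rewrite exprn_even_gt0.
pose G i j := rod_gap i j x * rod_gap i j y.
(* [far] treats the ends of rods in [S] away from [c], [near] their ends at [c]. *)
have far i j : i \in S -> pin_gap (t, c + rod_shift t i) j x *
    pin_gap (t, c + rod_shift t i) j y = if t then G j i else G i j.
  move=> iS; rewrite /pin_gap /= -{1}(Sx i iS) -{1}(Sy i iS) -!rod_endE
    !rod_gapE.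
  by rewrite /G; case: (t); rewrite ?mulrNN.
have near i j : i \in S -> pin_gap (~~ t, c) j x * pin_gap (~~ t, c) j y =
    if t then G i j else G j i.
  move=> iS; rewrite /pin_gap /= -{1}(Sx i iS) -{1}(Sy i iS) /G /rod_gap.
  by case: (t) => /=; ring.
have const i j z : i \in S -> j \in S -> pinned t c S z ->
    rod_gap i j z = rod_shift false (if t then j else i).
  move=> iS jS Sz; have := Sz i iS; have := Sz j jS.
  by rewrite /rod_gap /rod_shift /rod_end; case: (t) => /= zj zi; lra.
have cN q i : q \in P -> i \in S -> c != q.2 /\ c + rod_shift t i != q.2.
  move=> qP iS; move: cPM => /andP[/allP/(_ q qP)/asboolP cq _].
  split; apply/eqP => cq'; apply: cq; rewrite /= -cq'; first by rewrite subrr;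
    exact: signed_sum0.
  rewrite (_ : _ - _ = 0 + rod_shift (~~ t) i); last first.
    by rewrite /rod_shift; case: (t) => /=; ring.
  apply: (@signed_sumS [:: i]); first by move=> j; rewrite inE => /eqP->;
    exact: sSM.
  by apply: signed_sumD (signed_sum0 _) => //; exact: Mn (sSM _ iS).
have shift0 s i : i \in S -> rod_shift s i != 0.
  move=> iS; rewrite -[X in X != 0]add0r.
  by apply: (@signed_sum_shift [::] _ _ i) (signed_sum0 _) => //;
    exact: Mn (sSM _ iS).
have [k kS] : exists k, k \in S.
  by case: (S) S0 => // k S' _; exists k; rewrite mem_head.
have inM' i : i \in M -> i \notin S -> i \in [seq i <- M | i \notin S].
  by move=> iM iS; rewrite mem_filter iS.
have afterP i : i \in S -> (t, c + rod_shift t i) \in pins_after t c S P.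
  by move=> iS; rewrite mem_cat map_f.
have afterc : (~~ t, c) \in pins_after t c S P by rewrite mem_cat mem_head orbT.
split=> [[xyM xyP]|[xyM xyP]]; split=> [i j|p i].
- by rewrite !mem_filter => /andP[_ iM] /andP[_ jM]; exact: xyM.
- rewrite mem_filter => + /andP[_ iM].
  rewrite mem_cat => /orP[/mapP[j jS ->]|].
    by rewrite far //; case: (t); apply: xyM => //; exact: sSM.
  rewrite inE => /predU1P[->|pP]; last exact: xyP.
  by rewrite (near k) //; case: (t); apply: xyM => //; exact: sSM.
- move=> iM jM; rewrite -/(G i j).
  have [iS|iS] := boolP (i \in S); have [jS|jS] := boolP (j \in S).
  + rewrite /G !const //; apply/sq0/shift0; by case: (t).
  + move: (xyP _ j afterc (inM' j jM jS)) (xyP _ j (afterP i iS) (inM' j jM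
      jS)).
    by rewrite (near i) // far //; case: (t).
  + move: (xyP _ i afterc (inM' i iM iS)) (xyP _ i (afterP j jS) (inM' i iM
      iS)).
    by rewrite (near j) // far //; case: (t).
  + exact: xyM (inM' _ iM iS) (inM' _ jM jS).
- move=> pP iM; have [iS|iS] := boolP (i \in S); last first.
    by apply: xyP; [rewrite mem_cat inE pP !orbT|exact: inM'].
  have [cp cip] := cN p i pP iS.
  have pinE z : pinned t c S z ->
      pin_gap p i z = (if p.1 == t then c else c + rod_shift t i) - p.2.
    move=> Sz; rewrite /pin_gap; have [->|pt] := eqVneq; first by rewrite Sz.
    by rewrite (_ : ~~ p.1 = t) 1?rod_endE ?Sz //; case: (p.1) pt; case: (t).
  rewrite (pinE x Sx) (pinE y Sy); apply: sq0; rewrite subr_eq0.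
  by case: ifP.
Qed.

Lemma obstacles_ext P M x y f : (forall i, i \in M -> x i = y i) ->
  f \in obstacles P M -> f x = f y.
Proof.
move=> xy; rewrite mem_cat => /orP[]/allpairsP[[u v] /= [uM vM ->]].
  by rewrite /rod_gap /rod_end !xy.
by rewrite /pin_gap /rod_end xy.
Qed.

(* Removing a fixed point [(t, c)]: the flat where the rods in [S] touch it at
   [c] carries the arrangement of the remaining rods with the other ends of
   the rods in [S] as new fixed points, and with [c] itself now of the other
   type. *)
Lemma ncells_pinned t c S P M :
  (0 < size S)%N -> uniq S -> {subset S <= M} ->
  (forall i, i \in M -> (i < n)%N) -> pins_apart ((t, c) :: P) M ->
  ncells (pinned t c S) (obstacles P M) =
    ncells setT (obstacles (pins_after t c S P) [seq i <- M | i \notin S]).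
Proof.
move=> S0 uS sSM Mn cPM.
rewrite (eq_ncells (L2 := obstacles (pins_after t c S P) [seq i <- M | i \notin
  S])).
  set L := obstacles _ _; rewrite -[L in LHS]map_id.
  apply: (@ncells_comp _ _ _ id) => // x _.
  exists (fun i => if i \in S then (if t then c + a i else c) else x i) => [i
    iS|f fL].
    by rewrite /rod_end iS; case: (t) => /=; ring.
  by apply: obstacles_ext fL => i; rewrite mem_filter => /andP[/negbTE->].
by move=> x y Sx Sy; apply: same_side_pinned.
Qed.

Lemma same_side_comp T T' (phi : T -> T') (L : seq (T' -> R)) u v :
  same_side [seq f \o phi | f <- L] u v <-> same_side L (phi u) (phi v).
Proof.
split=> uv f; last by move=> /mapP[g gL ->]; exact: uv.
by move=> fL; apply: (uv (f \o phi)); apply/mapP; exists f.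
Qed.

(** Rod gaps are invariant under translation, so rod [i] may be moved to [x i = 0]; its ends become
    the fixed points 0 and [- a i]. *)
Lemma ncells_fix_rod i M : (i < n)%N -> i \notin M ->
  ncells setT (obstacles [::] (i :: M)) =
    ncells setT (obstacles [:: (true, 0); (false, - a i)] M).
Proof.
move=> lt_in iM; set P := [:: _; _].
pose phi x : point := fun j => x j - x i.
rewrite -[RHS](@ncells_comp _ _ _ phi setT) // => [|x _]; last first.
  exists (fun j => if j == i then 0 else x j) => // f;
    apply: obstacles_ext => j jM.
  by rewrite /phi eqxx subr0 ifN //; apply: contraNneq iM => <-.
apply: eq_ncells => x y _ _; rewrite same_side_comp !same_side_obstacles.
have gapE j k z : rod_gap j k (phi z) = rod_gap j k z.
  by rewrite /rod_gap /rod_end /phi; ring.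
have pin1 j z : pin_gap (true, 0) j (phi z) = rod_gap j i z.
  by rewrite /pin_gap /rod_gap /rod_end /phi /=; ring.
have pin2 j z : pin_gap (false, - a i) j (phi z) = - rod_gap i j z.
  by rewrite /pin_gap /rod_gap /rod_end /phi /=; ring.
split=> -[xyM xyP]; split=> //.
- by move=> j k jM kM; rewrite !gapE; apply: xyM; rewrite inE ?jM ?kM orbT.
- move=> p j; rewrite !inE => /orP[]/eqP-> jM; rewrite ?pin1 ?pin2 ?mulrNN.
    by apply: xyM; rewrite inE ?jM ?eqxx ?orbT.
  by apply: xyM; rewrite inE ?jM ?eqxx ?orbT.
- move=> j k; rewrite !inE => /predU1P[->|jM] /predU1P[->|kM].
  (* The gap of rod [i] to itself is the nonzero constant [- a i]. *)
  + rewrite (_ : rod_gap i i x = rod_gap i i y);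
      last by rewrite /rod_gap /rod_end; ring.
    rewrite -expr2 exprn_even_gt0 //= (_ : rod_gap i i y = 0 + rod_shift false
      i).
      exact: signed_sum_shift (signed_sum0 [::]).
    by rewrite /rod_gap /rod_end /rod_shift /=; ring.
  + by rewrite -mulrNN -!pin2; apply: xyP => //; rewrite !inE eqxx orbT.
  + by rewrite -!pin1; apply: xyP => //; rewrite !inE eqxx.
  + by rewrite -(gapE j k x) -(gapE j k y); exact: xyM.
Qed.

Lemma pins_apart_fix_rod i M : (i < n)%N -> i \notin M ->
  pins_apart [:: (true, 0); (false, - a i)] M.
Proof.
move=> lt_in iM; rewrite /pins_apart /= !andbT; apply/asboolP => /= ai.
apply: (negP (signed_sum_shift false lt_in iM ai)); apply/eqP.
by rewrite /rod_shift; ring.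
Qed.

(** The gaps from [(t, c)] to the rods have the dual directions [unit_point], so [ncells_pins]
    applies, with one flat per set of rods touching [c]. *)
Lemma ncells_unpin t c P M (h : nat -> nat) : uniq M ->
  (forall S, subseq S M -> ncells (pinned t c S) (obstacles P M) = h (size S))
    ->
  ncells setT (obstacles ((t, c) :: P) M) =
    (\sum_(s < (size M).+1) 'C(size M, s) * h s)%N.
Proof.
move=> uM hS.
rewrite (eq_ncells (L2 := [seq pin_gap (t, c) i | i <- M] ++ obstacles P M)).
  apply: (ncells_pins (e := unit_point)) => //.
  - by move=> i; exact: affine_pin_gap.
  - by move=> i j x u; rewrite /pin_gap rod_end_unit; ring.
  - exact: affine_obstacles.
  - by move=> i _ x _; exists 1.
  - move=> S sSM; rewrite -(hS _ sSM) setTI; congr ncells.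
    by apply/seteqP; split=> x /= Sx i iS; apply/eqP; have /eqP := Sx i iS;
      rewrite subr_eq0.
move=> x y _ _; rewrite same_side_cat !same_side_obstacles.
split=> [[xyM xyP]|[xyM [xyM' xyP]]].
  split=> [f /mapP[i iM ->]|]; first by apply: xyP; rewrite ?mem_head.
  by split=> // p i pP iM; apply: xyP; rewrite // inE pP orbT.
split=> // p i; rewrite inE => /predU1P[->|pP] iM; last exact: xyP.
by apply: (xyM (pin_gap (t, c) i)); exact: map_f.
Qed.

Lemma size_filter_notin S M : uniq M -> subseq S M ->
  size [seq i <- M | i \notin S] = (size M - size S)%N.
Proof.
move=> uM /(subseq_uniqP uM) SE.
have := count_predC (mem S) M; rewrite -!size_filter -SE => <-.
by rewrite addKn.
Qed.

Variable F : nat -> nat -> nat.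
Hypothesis F00 : F 0 0 = 1%N.
Hypothesis F0S : forall m, F 0 m.+1 = F 2 m.
Hypothesis FS : forall k m, F k.+1 m =
  (\sum_(s < m.+1) 'C(m, s) * if s == 0 :> nat then F k m else F (k + s).+1 (m
    - s))%N.

(** Outer induction on the number of rods, inner on the fixed points: fixing a rod or a nonempty [S]
    lowers the first number, an empty [S] the second. *)
Lemma ncells_obstacles P M : uniq M -> (forall i, i \in M -> (i < n)%N) ->
  pins_apart P M -> ncells setT (obstacles P M) = F (size P) (size M).
Proof.
move: {2}(size M).+1 (ltnSn (size M)) => m; elim: m M P => // m IHm M P.
rewrite ltnS => leMm uM Mn; elim: P => [|[t c] P IHP] cPM.
  case: M uM Mn leMm {cPM} => [_ _ _|i M /= /andP[iM uM] Mn leMm].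
    by rewrite ncells_nil asboolT //; exists (fun=> 0).
  have lt_in : (i < n)%N by apply: Mn; rewrite mem_head.
  rewrite ncells_fix_rod // F0S IHm //; last exact: pins_apart_fix_rod.
  by move=> j jM; apply: Mn; rewrite inE jM orbT.
rewrite FS; pose h s := if s == 0%N then F (size P) (size M)
  else F (size P + s).+1 (size M - s).
apply: (ncells_unpin (h := h)) => // S sSM; rewrite /h.
have uS := subseq_uniq sSM uM.
have [S0|S0] := eqVneq (size S) 0%N.
  rewrite -IHP; last by case/andP: cPM.
  by rewrite (size0nil S0); congr ncells; apply/seteqP; split.
have sSM' := mem_subseq sSM.
rewrite (ncells_pinned (t := t)) ?lt0n // IHm.
- rewrite size_filter_notin // size_cat size_map /= addnS addnC; congr F.
- rewrite size_filter_notin //; apply: leq_trans leMm;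
    rewrite ltn_subrL lt0n S0 /=.
  by apply: leq_trans (size_subseq sSM); rewrite lt0n.
- exact: filter_uniq.
- by move=> i; rewrite mem_filter => /andP[_ /Mn].
- apply: pins_apart_after cPM => // [i|i iS];
    first by rewrite mem_filter => /andP[].
  by rewrite mem_filter iS /=; split=> //; apply/Mn/sSM'.
Qed.

End Generic.
End Rods.

(** * Power series *)

Section FpsRing.
Context {K : fieldType}.
Implicit Types f g h u v : fps K.

(** Degree [n] only sees truncations, so commutativity and associativity are inherited from
    polynomials. *)
Lemma fps_mulE f g n N : (n < N)%N ->
  fps_mul f g n = (\poly_(i < N) f i * \poly_(i < N) g i)`_n.
Proof.
move=> lt_nN; rewrite coefM; apply: eq_bigr => i _; rewrite !coef_poly.
have le_in : (i <= n)%N by rewrite -ltnS.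
by rewrite (leq_ltn_trans le_in lt_nN) (leq_ltn_trans (leq_subr _ _) lt_nN).
Qed.

Lemma fps_mulC : commutative (@fps_mul K).
Proof.
by move=> f g; apply/funext => n; rewrite !(@fps_mulE _ _ n n.+1) // mulrC.
Qed.

Lemma fps_mulDl (f g h : nat -> K) :
  fps_mul (f + g) h = (fps_mul f h : nat -> K) + (fps_mul g h : nat -> K).
Proof.
apply/funext => n; rewrite /fps_mul !fctE -big_split /=.
by apply: eq_bigr => i _; rewrite mulrDl.
Qed.

Lemma fps_mulA : associative (@fps_mul K).
Proof.
have trunc f g n : \poly_(i < n) fps_mul f g i =
    take_poly n (\poly_(i < n) f i * \poly_(i < n) g i).
  apply/polyP => i; rewrite coef_poly coef_take_poly.
  by case: ltnP => // lt_in; rewrite (fps_mulE _ _ lt_in).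
have coef_take n (p q : {poly K}) : (take_poly n.+1 p * q)`_n = (p * q)`_n.
  rewrite !coefM; apply: eq_bigr => i _; by rewrite coef_take_poly ltn_ord.
move=> f g h; apply/funext => n; rewrite !(@fps_mulE _ _ n n.+1) // !trunc.
by rewrite mulrC !coef_take mulrC mulrA.
Qed.

Lemma fps_mul1 : left_id (fps_const 1) (@fps_mul K).
Proof.
move=> f; apply/funext => n; rewrite /fps_mul big_ord_recl mul1r subn0.
by rewrite big1 ?addr0 // => i _; rewrite mul0r.
Qed.

Lemma fps_const1_neq0 : fps_const 1 != (0 : nat -> K).
Proof. by apply/eqP => /(congr1 (@^~ 0%N))/eqP; rewrite oner_eq0. Qed.

(* The ring product is [fps_mul], not the pointwise one of [nat -> K]. *)
HB.instance Definition _ := GRing.Zmodule.copy (fps K) (nat -> K).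
HB.instance Definition _ := GRing.Zmodule_isComNzRing.Build (fps K)
  fps_mulA fps_mulC fps_mul1 fps_mulDl fps_const1_neq0.

Lemma coef_fpsD f g n : (f + g) n = f n + g n. Proof. by []. Qed.
Lemma coef_fpsB f g n : (f - g) n = f n - g n. Proof. by []. Qed.

Lemma coef_fpsM f g n : (f * g) n = \sum_(i < n.+1) f i * g (n - i)%N.
Proof. by []. Qed.

Lemma coef_fps_sum I (r : seq I) (F : I -> fps K) n :
  (\sum_(i <- r) F i) n = \sum_(i <- r) F i n.
Proof.
by elim/big_rec2: _ => // i x y _ <-.
Qed.

Lemma fps_powE f k : fps_pow f k = f ^+ k.
Proof. by elim: k => // k IHk; rewrite exprS -IHk. Qed.

Lemma coef_fps_constM c f n : (fps_const c * f : fps K) n = c * f n.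
Proof.
rewrite coef_fpsM big_ord_recl /= subn0 big1 ?addr0 // => i _; exact: mul0r.
Qed.

Lemma coef_fpsXM f n : (fps_X * f : fps K) n = if n is m.+1 then f m else 0.
Proof.
rewrite coef_fpsM big_ord_recl /fps_X /= mul0r add0r.
case: n => [|n]; first by rewrite big_ord0.
rewrite big_ord_recl big1 => [|i _]; last exact: mul0r.
by rewrite addr0 mul1r /= /bump subn1.
Qed.

Lemma coef_fpsXnM k f n :
  ((fps_X : fps K) ^+ k * f) n = if (k <= n)%N then f (n - k)%N else 0.
Proof.
elim: k n => [|k IHk] n; first by rewrite expr0 mul1r subn0.
by rewrite exprS -mulrA coef_fpsXM; case: n => // n; rewrite IHk.
Qed.

Definition fps_agree n f g := forall i, (i < n)%N -> f i = g i.

Lemma fps_agreeM n f f' g g' :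
  fps_agree n f f' -> fps_agree n g g' -> fps_agree n (f * g) (f' * g').
Proof.
move=> ff' gg' i lt_in; rewrite !coef_fpsM; apply: eq_bigr => j _;
  congr (_ * _).
  by apply: ff'; exact: leq_trans (ltn_ord j) lt_in.
by apply: gg'; exact: leq_ltn_trans (leq_subr _ _) lt_in.
Qed.

Lemma fps_agreeX n f g k : fps_agree n f g -> fps_agree n (f ^+ k) (g ^+ k).
Proof.
by move=> fg; elim: k => // k IHk; rewrite !exprS; exact: fps_agreeM.
Qed.

Definition fps_contracting (Phi : fps K -> fps K) :=
  forall n f g, fps_agree n f g -> fps_agree n.+1 (Phi f) (Phi g).

(** Contraction for the x-adic metric: coefficients below [m] are stable from the [m]-th iterate on,
    so coefficient [n] is read off iterate [n.+1]. *)
Lemma fps_fixpoint Phi : fps_contracting Phi ->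
  exists2 f, Phi f = f & forall g, Phi g = g -> f = g.
Proof.
move=> Phi_c; have agree_iter n m m' : (n <= m)%N -> (n <= m')%N ->
    fps_agree n (iter m Phi 0) (iter m' Phi 0).
  elim: n m m' => // n IHn [|m] [|m'] // le_nm le_nm'.
  by rewrite !iterS; apply: Phi_c; exact: IHn.
exists (fun n => iter n.+1 Phi 0 n) => [|g Phig].
  apply/funext => n; rewrite [RHS]/= ; apply: (Phi_c n) => // i lt_in.
  exact: (agree_iter i.+1).
apply/funext => n; move: {-2}n (ltnSn n).
suff agree_g m : fps_agree m (iter m Phi 0) g by move=> i _;
  exact: (agree_g i.+1).
by elim: m => // m IHm; rewrite iterS -Phig; exact: Phi_c.
Qed.

End FpsRing.

(** * The equations of y and z as contracting fixed-point equations *)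

Section TreeSeries.
Context {K : numFieldType}.
Implicit Types f g u v w y : fps K.

Lemma coef_fps_expX u n :
  fps_exp (fps_mul fps_X u) n = \sum_(k < n.+1) (u ^+ k) (n - k)%N / (k`!)%:R.
Proof.
apply: eq_bigr => k _; rewrite fps_powE; congr (_ / _).
have -> : fps_mul fps_X u ^+ k = fps_X ^+ k * u ^+ k by rewrite -exprMn.
by rewrite coef_fpsXnM -ltnS ltn_ord.
Qed.

Lemma coef_mul_expX f u n : (f * fps_exp (fps_mul fps_X u)) n =
  \sum_(k < n.+1) (f * u ^+ k) (n - k)%N / (k`!)%:R.
Proof.
(* The exponential series cut after exponent [n]; the omitted terms have order above [n]. *)
pose e : fps K := \sum_(k < n.+1) fps_const (k`!)%:R^-1 * (fps_X ^+ k * u ^+ k).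
transitivity ((f * e) n).
  apply: (@fps_agreeM _ n.+1) => // j; rewrite ltnS => le_jn.
  rewrite coef_fps_expX /e coef_fps_sum.
  under [RHS]eq_bigr do rewrite coef_fps_constM coef_fpsXnM.
  rewrite (big_ord_widen n.+1 (fun k => (u ^+ k) (j - k)%N / (k`!)%:R)) //.
  rewrite big_mkcond /=; apply: eq_bigr => k _; rewrite ltnS.
  by case: leqP => _; rewrite ?mulr0 // mulrC.
rewrite /e mulr_sumr coef_fps_sum; apply: eq_bigr => k _.
rewrite mulrCA coef_fps_constM mulrCA coef_fpsXnM -ltnS ltn_ord mulrC.
by [].
Qed.

Definition tree_eq u := 1 + u * (fps_exp (fps_mul fps_X u) - 1).

(** The series e^(xu) - 1 has no constant term, and its coefficient in degree [j] involves only
    coefficients of [u] below [j]. *)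
Lemma tree_eq_contracting : fps_contracting tree_eq.
Proof.
have e0 u : (fps_exp (fps_mul fps_X u) - 1) 0%N = 0.
  by rewrite coef_fpsB coef_fps_expX big_ord1 divr1 subrr.
move=> n f g fg m lt_mn; rewrite /tree_eq !coef_fpsD; congr (_ + _).
have ee : fps_agree n.+1 (fps_exp (fps_mul fps_X f) - 1)
                         (fps_exp (fps_mul fps_X g) - 1).
  move=> j lt_jn; rewrite !coef_fpsB; congr (_ - _); rewrite !coef_fps_expX.
  apply: eq_bigr => k _; congr (_ / _).
  have [->|k0] := posnP k; first by rewrite !expr0.
  apply: (@fps_agreeX _ n f g k fg (j - k)%N).
  have le_kj : (k <= j)%N by rewrite -ltnS.
  apply: leq_trans (_ : j <= n)%N => //.
  by rewrite ltn_subrL k0 (leq_trans k0 le_kj).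
(* The top coefficients [f m] and [g m], which may differ, meet the zero constant term. *)
rewrite !coef_fpsM !big_ord_recr /= subnn !e0 !mulr0; congr (_ + _).
apply: eq_bigr => i _; congr (_ * _).
  by apply: fg; apply: leq_trans (ltn_ord i) _.
by apply: ee; apply: leq_ltn_trans (leq_subr _ _) lt_mn.
Qed.

Lemma tree_eqP u : fps_const 1 =
  fps_mul u (fps_sub (fps_const 2) (fps_exp (fps_mul fps_X u))) <->
  tree_eq u = u.
Proof.
rewrite /tree_eq; set e := fps_exp _.
have two : fps_const 2 = 1 + 1 :> fps K.
  apply/funext => -[|n]; rewrite coef_fpsD;
    [exact: (natrD K 1 1)|exact/esym/addr0].
rewrite two -[fps_mul _ _]/(u * (1 + 1 - e)).
have -> : u * (1 + 1 - e) = u - u * (e - 1) by ring.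
rewrite -[fps_const 1]/(1 : fps K); split=> uE; first by rewrite {1}uE subrK.
by rewrite -{1}uE addrK.
Qed.

(** Multiplying the equation gives v y^(k+1) = v y^k - v y^(k+1) + v y^(k+1) e^(xy), where the
    exponent 0 term of the exponential cancels the middle term. The factor [v] will be 1 or z. *)
Lemma tree_eq_recursion y v k m : tree_eq y = y ->
  (v * y ^+ k.+1) m * (m`!)%:R =
  \sum_(s < m.+1) 'C(m, s)%:R * (if s == 0 :> nat then (v * y ^+ k) m * (m`!)%:R
    else (v * y ^+ (k + s).+1) (m - s)%N * ((m - s)`!)%:R).
Proof.
move=> yE; have -> : v * y ^+ k.+1 = v * y ^+ k - v * y ^+ k.+1 +
    v * y ^+ k.+1 * fps_exp (fps_mul fps_X y).
  set e := fps_exp _; have -> : v * y ^+ k.+1 = v * y ^+ k * y by rewrite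
    exprSr mulrA.
  by rewrite [LHS](congr1 ( *%R (v * y ^+ k)) (esym yE)) /tree_eq -/e; ring.
rewrite coef_fpsD coef_fpsB coef_mul_expX !big_ord_recl expr0 mulr1 subn0 divr1.
rewrite addrA subrK mulrDl bin0 mul1r /=; congr (_ + _).
rewrite mulr_suml; apply: eq_bigr => s _;
  rewrite -[v * _ * _]mulrA -exprD addSn -mulrA.
rewrite [RHS]mulrCA; congr (_ * _).
have le_sm : (bump 0 s <= m)%N by rewrite /bump /= add1n ltn_ord.
by rewrite -(bin_fact le_sm) natrM [X in _ * (_ * X)]natrM mulrCA mulKf //
  pnatr_eq0 -lt0n fact_gt0.
Qed.

(** The integrated form of w' = w y^2, w(0) = 1. *)
Definition deriv_eq y w : fps K :=
  fun n => if n is m.+1 then (w * y ^+ 2) m / m.+1%:R else 1.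

Lemma deriv_eq_contracting y : fps_contracting (deriv_eq y).
Proof.
move=> n f g fg [|m] //; rewrite ltnS => lt_mn /=; congr (_ / _).
exact: (fps_agreeM fg (fun _ _ => erefl _)).
Qed.

Lemma deriv_eqP y w :
  fps_div (fps_deriv w) w = fps_pow y 2 /\ w 0%N = 1 <-> deriv_eq y w = w.
Proof.
have derivP : fps_deriv w = w * y ^+ 2 <->
    forall m, w m.+1 = (w * y ^+ 2) m / m.+1%:R.
  split=> [dw m|dw].
    by rewrite -dw /fps_deriv mulrC mulKf // pnatr_eq0.
  by apply/funext => m; rewrite /fps_deriv dw mulrC divfK // pnatr_eq0.
split=> [[dw w0]|wE].
  apply/funext => -[|m] //=; apply/esym; apply: derivP.1.
  have w0' : w 0%N != 0 by rewrite w0 oner_eq0.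
  rewrite -fps_powE -dw /fps_div -[fps_mul _ _]/(fps_deriv w * fps_inv w).
  by rewrite mulrC -mulrA -[_ * w]/(fps_mul _ _) fps_mulVf // [LHS](esym (mulr1
    _)).
have w0 : w 0%N = 1 by rewrite -wE.
split=> //; rewrite fps_powE /fps_div (derivP.2 _) => [|m];
  last by rewrite -{1}wE.
rewrite -[fps_mul _ _]/(w * y ^+ 2 * fps_inv w) mulrAC mulrC.
have -> : w * fps_inv w = 1 by rewrite mulrC; apply: fps_mulVf;
  rewrite w0 oner_eq0.
by rewrite mulr1.
Qed.

End TreeSeries.

(** * Computing the solutions of the recursions *)

(* For [b = true] this is m! [x^m] (z y^k), for [b = false] m! [x^m] y^k. *)
Fixpoint rod_count_fuel (b : bool) (n k m : nat) : nat :=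
  if n is n'.+1 then
    (fix loop k := if k is k'.+1 then
       (loop k' + sumn [seq 'C(m, s) * rod_count_fuel b n' (k' + s).+1 (m - s)
                       | s <- iota 1 m])%N
     else if m is m'.+1 then (if b then rod_count_fuel b n' 2 m' else 0%N)
     else 1%N) k
  else 0%N.

Definition rod_count b k m := rod_count_fuel b m.+1 k m.

(** Fuel is spent only when [m] decreases, so any fuel above [m] gives the same value. *)
Lemma rod_count_fuelE b n n' k m : (m < n)%N -> (m < n')%N ->
  rod_count_fuel b n k m = rod_count_fuel b n' k m.
Proof.
elim: n n' k m => // n IHn [|n'] // k m lt_mn lt_mn'; elim: k => [|k IHk] /=.
  by case: m lt_mn lt_mn' => // m lt_mn lt_mn'; rewrite (IHn n').
congr (_ + sumn _)%N; first exact: IHk.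
apply/eq_in_map => s; rewrite mem_iota.
move=> /andP[s0 le_sm]; congr (_ * _)%N.
have lt_sm : (m - s < m)%N by rewrite ltn_subrL s0; apply: leq_trans s0 _.
by apply: IHn; apply: leq_trans lt_sm _; rewrite -ltnS.
Qed.

Lemma rod_count00 b : rod_count b 0 0 = 1%N. Proof. by []. Qed.

Lemma rod_count0S b m : rod_count b 0 m.+1 = if b then rod_count b 2 m else 0%N.
Proof. by []. Qed.

Lemma rod_countS b k m : rod_count b k.+1 m =
  (\sum_(s < m.+1) 'C(m, s) * if s == 0 :> nat then rod_count b k m
    else rod_count b (k + s).+1 (m - s))%N.
Proof.
rewrite big_ord_recl bin0 mul1n; congr (_ + _)%N.
rewrite sumnE big_map (_ : iota 1 m = index_iota 1 m.+1); last first.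
  by rewrite /index_iota subn1.
rewrite big_add1 /= big_mkord.
apply: eq_bigr => s _; congr (_ * _)%N.
apply: rod_count_fuelE => //; rewrite ltn_subrL /=.
by apply: leq_trans (ltn_ord s).
Qed.

Lemma rod_count_unique (K : numFieldType) b (G : nat -> nat -> K) :
  G 0%N 0%N = 1 ->
  (forall m, G 0%N m.+1 = if b then G 2%N m else 0) ->
  (forall k m, G k.+1 m = \sum_(s < m.+1) 'C(m, s)%:R *
     (if s == 0 :> nat then G k m else G (k + s).+1 (m - s)%N)) ->
  forall k m, G k m = (rod_count b k m)%:R.
Proof.
move=> G00 G0S GS k m; elim/ltn_ind: m k => m IHm; elim=> [|k IHk].
  case: m IHm => [|m] IHm; first by rewrite G00.
  by rewrite G0S rod_count0S; case: b {G0S} IHm => // IHm; rewrite IHm.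
rewrite GS rod_countS natr_sum; apply: eq_bigr => s _; rewrite natrM.
congr (_ * _); case: eqP => // /eqP s0; apply: IHm.
have le_sm : (s <= m)%N by rewrite -ltnS.
by rewrite ltn_subrL !lt0n s0 -lt0n (leq_trans _ le_sm) // lt0n.
Qed.

Lemma rod_count_z : [seq rod_count true 0 n | n <- iota 0 7] =
  [:: 1; 1; 3; 19; 195; 2831; 53703]%N.
Proof. by apply/eqP; vm_compute. Qed.

Lemma rod_count_y : [seq rod_count false 1 n | n <- iota 0 6] =
  [:: 1; 1; 5; 46; 631; 11586]%N.
Proof. by apply/eqP; vm_compute. Qed.

(** * Regions of the generic arrangement *)

Section GenericSigns.
Context {R : realType}.

Lemma generic_signs (a : nat -> R) n (e : nat -> R) : generic a -> signs e ->
  \sum_(i < n) e i * a i = 0 -> forall i, (i < n)%N -> e i = 0.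
Proof.
(* The partial sums P 0, ..., P n = 0 become the positions of extra points
   x_(u t); an extra rod s t with x_(s t) - a_(s t) = P t allows to express
   that x_i = P t.  The rod t joins P t and P t.+1, in the order given by the
   sign e t, so that the family S of all hyperplanes through this
   configuration forces \sum_t e t * b t = 0 for every parameter b for which
   it is central. *)
move=> ha es sum0.
pose N := (n + n.+1 + n)%N; pose u t := (n + t)%N; pose s t := (n + n.+1 + t)%N.
pose P t := - \sum_(i < t) e i * a i.
have PS t : P t.+1 = P t - e t * a t by rewrite /P big_ord_recr /= opprD.
pose X k := if (k < n)%N then (if e k == 1 then P k else P k.+1)
  else if (k < n + n.+1)%N then P (k - n)%N else P (k - (n + n.+1))%N + a k.
have Xu t : (t <= n)%N -> X (u t) = P t.
  by move=> tn; rewrite /X /u ltnNge leq_addr /= ltn_add2l ltnS tn addKn.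
have Xs t : X (s t) = P t + a (s t).
  rewrite /X /s ltnNge -addnA leq_addr /= addnA ltnNge leq_addr /=.
  by rewrite addnC addnK.
pose S : {set 'I_N.+1 * 'I_N.+1} :=
  [set p : 'I_N.+1 * 'I_N.+1 | (p.1 != p.2) && (X p.1 - X p.2 == a p.1)]%SET.
have S_neq p : p \in S -> p.1 != p.2 by rewrite inE => /andP[].
(* The choice of [e] itself as parameter [b] turns the forced relation into a vanishing sum of
   squares. The common point for [a] is [X] translated to coordinate sum zero. *)
have [|y Sy] := ha N.+1 S S_neq _ e.
  pose m := (\sum_(k < N.+1) X k) / N.+1%:R.
  exists (\row_k (X k - m)) => p /=; rewrite inE => /andP[_ /eqP Xp]; split.
    rewrite /Vsum0 /=; under eq_bigr do rewrite mxE.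
    by rewrite sumrB sumr_const card_ord -mulr_natr /m divfK ?subrr //
      pnatr_eq0.
  by rewrite !mxE -Xp; ring.
pose Y k := y 0 (inord k).
have edge i j : (i <= N)%N -> (j <= N)%N -> i != j -> X i - X j = a i ->
    Y i - Y j = e i.
  move=> iN jN ij Xij; have := Sy (inord i, inord j).
  rewrite /= inE /= -(inj_eq val_inj) /= !inordK ?ltnS // ij Xij eqxx.
  by move=> /(_ isT)[_ /=]; rewrite inordK.
have uN t : (t <= n)%N -> (u t <= N)%N by rewrite /u /N; lia.
have sN t : (t <= n)%N -> (s t <= N)%N by rewrite /s /N; lia.
have su t t' : (t <= n)%N -> (t' <= n)%N -> P t = P t' -> Y (s t) - Y (u t') =
  e (s t).
  move=> tn t'n Pt; apply: edge; rewrite ?uN ?sN //; first by rewrite /s /u;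
    lia.
  by rewrite Xs Xu // Pt; ring.
(* Each step lowers [Y (u t)] by the square of [e t]: for sign -1 or 1 through rod [t], for sign 0
   because rod [s t] touches both points. *)
have Yu t : (t < n)%N -> Y (u t.+1) = Y (u t) - e t * e t.
  move=> tn; have tN : (t <= N)%N by rewrite /N; lia.
  have := es t; rewrite !inE => /or3P[]/eqP et.
  - have Xt : X t = P t.+1 by rewrite /X tn et ifN // lt_eqF //; lra.
    have tu : Y t - Y (u t) = e t.
      apply: edge; rewrite ?uN ?(ltnW tn) //; first by rewrite /u; lia.
      by rewrite Xt Xu ?(ltnW tn) // PS et; ring.
    have st : Y (s t.+1) - Y t = e (s t.+1).
      apply: edge; rewrite ?sN //; first by rewrite /s; lia.
      by rewrite Xs Xt; ring.
    have := su t.+1 t.+1 tn tn erefl; move: tu st; rewrite et; lra.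
  - have := su t t.+1 (ltnW tn) tn; rewrite PS et mul0r subr0 => /(_ erefl).
    have := su t t (ltnW tn) (ltnW tn) erefl; lra.
  - have Xt : X t = P t by rewrite /X tn et eqxx.
    have tu : Y t - Y (u t.+1) = e t.
      apply: edge; rewrite ?uN //; first by rewrite /u; lia.
      by rewrite Xt Xu // PS et; ring.
    have st : Y (s t) - Y t = e (s t).
      apply: edge; rewrite ?sN ?(ltnW tn) //; first by rewrite /s; lia.
      by rewrite Xs Xt; ring.
    have := su t t (ltnW tn) (ltnW tn) erefl; move: tu st; rewrite et; lra.
have YuE t : (t <= n)%N -> Y (u t) = Y (u 0%N) - \sum_(i < t) e i * e i.
  elim: t => [|t IHt] tn; first by rewrite big_ord0 subr0.
  by rewrite Yu // IHt ?(ltnW tn) // big_ord_recr /=; ring.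
(* The chain closes up: as [P 0 = P n], rod [s 0] touches both [u 0] and [u n]. *)
have sqr0 : \sum_(i < n) e i * e i = 0.
  have P0 : P 0%N = P n by rewrite /P sum0 big_ord0.
  have := su 0%N n (leq0n _) (leqnn _) P0; rewrite YuE //.
  have := su 0%N 0%N (leq0n _) (leq0n _) erefl; lra.
move=> i lt_in; apply/eqP; rewrite -[_ == 0]orbb -mulf_eq0.
have /eqP := sqr0; rewrite psumr_eq0 => [/allP/(_ (Ordinal lt_in))|j _].
  by rewrite mem_index_enum => /(_ isT).
by rewrite -expr2 sqr_ge0.
Qed.

End GenericSigns.

(** * Cells as connected components *)

Section Regions.
Context {R : realType}.

Lemma cellsP T (D : set T) (L : seq (T -> R)) X : X \in cells D L ->
  X !=set0 /\ forall x, X x -> [/\ D x, same_side L x x &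
    forall y, X y <-> D y /\ same_side L x y].
Proof.
elim: L D => [|f L IHL] D /=.
  case: asboolP => // D0; rewrite inE => /eqP->; split=> // x Dx.
  by split=> // y; split=> [|[]].
rewrite mem_cat => /orP[]/IHL[X0 XD]; split=> // x /XD[[Dx /= fx] xx xy];
  (split=> //; first by apply/same_side_cons; split=> //; nra);
  move=> y; rewrite xy same_side_cons;
    split=> [[[Dy /= fy] xLy]|[Dy [fxy xLy]]];
  by do ?split=> //=; nra.
Qed.

Lemma cells_cover T (D : set T) (L : seq (T -> R)) x :
  D x -> (forall f, f \in L -> f x != 0) -> exists2 X, X \in cells D L & X x.
Proof.
elim: L D => [|f L IHL] D Dx Lx /=.
  by exists D => //; case: asboolP => [_|[]]; [rewrite mem_head|exists x].
have {}IHL D' : D' x -> exists2 X, X \in cells D' L & X x.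
  by move=> D'x; apply: IHL => // g gL; apply: Lx; rewrite inE gL orbT.
have [fx|fx|fx] := ltrgt0P (f x).
- by have [|X XL Xx] := IHL (D `&` [set x | 0 < f x]); last exists X;
    rewrite // mem_cat XL.
- by have [|X XL Xx] := IHL (D `&` [set x | f x < 0]); last exists X;
    rewrite // mem_cat XL orbT.
- by have := Lx f (mem_head _ _); rewrite fx eqxx.
Qed.

Lemma cells_uniq T (D : set T) (L : seq (T -> R)) : uniq (cells D L).
Proof.
elim: L D => [|f L IHL] D /=; first by case: asboolP.
rewrite cat_uniq !IHL andbT /=; apply/hasPn => X /cellsP[[x Xx] Xneg].
apply/negP => /cellsP[_ /(_ x Xx)[[_ /= fx] _ _]].
by have [[_ /= fx'] _ _] := Xneg x Xx; lra.
Qed.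

(** A connected subset of the complement meets only one side of each [f], by the intermediate value
    theorem, and a cell is joined by segments, being convex. *)
Lemma card_components n (D : set 'rV[R]_n) (L : seq ('rV[R]_n -> R)) C :
  convex_set D -> (forall f, f \in L -> affine_fun f) ->
  (forall f, f \in L -> continuous f) ->
  C = [set x | D x /\ forall f, f \in L -> f x != 0] ->
  #|` fset_set (connected_component C @` C)| = ncells D L.
Proof.
move=> DC LA Lc CE.
have segN0 (t u v : R) : 0 <= t <= 1 -> 0 < u * u -> 0 < u * v ->
    (1 - t) * u + t * v != 0.
  move=> /andP[t0 t1] uu uv; suff: 0 < u * ((1 - t) * u + t * v).
    by case: eqP => // ->; rewrite mulr0 ltxx.
  rewrite mulrDr mulrCA [X in _ + X]mulrCA.
  have [->|tN0] := eqVneq t 0; first by rewrite mul0r addr0 subr0 mul1r.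
  have t_gt0 : 0 < t by rewrite lt_neqAle eq_sym tN0.
  by apply: ltr_wpDl; [rewrite mulr_ge0 ?subr_ge0 // ltW|exact: mulr_gt0].
have compE X x : X \in cells D L -> X x -> connected_component C x = X.
  move=> XL Xx; have [_ /(_ x Xx)[Dx xx xX]] := cellsP XL.
  apply/seteqP; split=> [y [A [Ax AC Ac] Ay]|y Xy].
    apply/xX; have := AC y Ay; rewrite CE => -[Dy y0]; split=> // f fL.
    have : is_interval (f @` A).
      apply/connected_intervalP/connected_continuous_connected => //.
      exact/continuous_subspaceT/Lc.
    move=> fAi; rewrite ltNge; apply/negP => fxy.
    have [z Az fz] : (f @` A) 0.
      have := xx f fL; have [fx|fx|->] := ltrgt0P (f x);
        last by rewrite mul0r ltxx.
        move=> _; apply: (fAi (f y) (f x)); [by exists y|by exists x|].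
        by rewrite (ltW fx) andbT -(pmulr_rle0 _ fx).
      move=> _; apply: (fAi (f x) (f y)); [by exists x|by exists y|].
      by rewrite (ltW fx) -(nmulr_rle0 _ fx).
    by have := AC z Az; rewrite CE => -[_ /(_ f fL)]; rewrite fz eqxx.
  exists ((fun t : R => (1 - t) *: x + t *: y) @` [set t | 0 <= t <= 1]).
    split.
    - by exists 0 => /=; rewrite ?lexx ?ler01 // subr0 scale1r scale0r addr0.
    - move=> z [t /= t01 <-]; rewrite CE; have [Dy xy] := (xX y).1 Xy.
      split=> [|f fL]; first exact: DC.
        by rewrite LA //; apply: segN0 => //; [exact: xx|exact: xy].
    - apply: connected_continuous_connected.
        apply/connected_intervalP => u v /= /andP[u0 _] /andP[_ v1] t /andP[ut
          tv].
        by rewrite (le_trans u0 ut) (le_trans tv v1).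
      apply: continuous_subspaceT => t; apply: cvgD; apply: cvgZr_tmp => //.
      by apply: cvgB; [exact: cvg_cst|exact: cvg_id].
  by exists 1 => /=; rewrite ?lexx ?ler01 // subrr scale1r scale0r add0r.
have -> : connected_component C @` C = [set` [fset X in cells D L]%fset].
  apply/seteqP; split=> X; rewrite /= in_fset.
    move=> [x Cx <-]; move: (Cx); rewrite {1}CE => -[Dx Lx].
    by have [X' X'L X'x] := cells_cover Dx Lx; rewrite (compE X').
  move=> XL; have [[x Xx] /(_ x Xx)[Dx xx _]] := cellsP XL.
  exists x; last exact: compE.
  rewrite CE; split=> // f /xx; case: eqP => // ->; rewrite mul0r ltxx //.
rewrite set_fsetK card_fseq undup_id //; exact: cells_uniq.
Qed.

End Regions.

(** * The number of regions of the generic arrangement *)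

Section CountG.
Context {R : realType}.

Lemma num_regions_GE (a : nat -> R) n : generic a ->
  num_regions_G a n = rod_count true 0 n.
Proof.
move=> ha; case: n => // n.
have a_gen e := @generic_signs R a n.+1 e ha.
have Mn i : i \in iota 0 n.+1 -> (i < n.+1)%N by rewrite mem_iota.
have := ncells_obstacles a_gen (rod_count00 true) (rod_count0S true)
  (rod_countS true) (iota_uniq 0 n.+1) Mn (isT : pins_apart a n.+1 [::] _).
rewrite size_iota => <-.
pose phi (x : 'rV[R]_n.+1) : nat -> R^o := fun i => x 0 (inord i).
set L := obstacles _ _ _.
rewrite -(@ncells_comp _ _ _ phi (@Vsum0 R n.+1) setT L) // => [|x _];
  last first.
  (* Subtracting the mean reaches coordinate sum zero without changing any gap. *)
  pose m := (\sum_(i < n.+1) x i) / n.+1%:R.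
  exists (\row_i (x i - m)).
    rewrite /Vsum0 /=; under eq_bigr do rewrite mxE.
    by rewrite sumrB sumr_const card_ord -mulr_natr /m divfK ?subrr //
      pnatr_eq0.
  move=> f; rewrite mem_cat => /orP[]/allpairsP[[i j] /= [iM jM ->]] //.
  rewrite /rod_gap /rod_end /phi !mxE !inordK ?Mn //; ring.
have rodE (x : 'rV[R]_n.+1) (i j : 'I_n.+1) :
    rod_gap a i j (phi x) = x 0 i - x 0 j - a i.
  by rewrite /rod_gap /rod_end /phi !inord_val; ring.
have LP f : f \in [seq g \o phi | g <- L] ->
    exists i j : 'I_n.+1, f = fun x => x 0 i - x 0 j - a i.
  move=> /mapP[g + ->]; rewrite mem_cat => /orP[]/allpairsP[[i j] /= [iM jM
    ->]] //.
  exists (Ordinal (Mn i iM)), (Ordinal (Mn j jM)); apply/funext => x /=.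
  by rewrite -rodE.
apply: card_components.
- move=> x y t; rewrite /Vsum0 /= => Dx Dy _.
  under eq_bigr do rewrite !mxE.
  by rewrite big_split /= -!mulr_sumr Dx Dy !mulr0 addr0.
- by move=> f /LP[i [j ->]] x y t; rewrite !mxE; ring.
- have contB (g h : 'rV[R]_n.+1 -> R^o) :
      continuous g -> continuous h -> continuous (fun x => g x - h x).
    by move=> cg ch x; exact: continuousB (cg x) (ch x).
  move=> f /LP[i [j ->]]; apply: (contB (fun x => x 0 i - x 0 j) (fun=> a i)).
    exact: contB (@coord_continuous R _ _ 0 i) (@coord_continuous R _ _ 0 j).
  by move=> x; exact: cst_continuous.
apply/seteqP; split=> x.
  move=> [Dx xA]; split=> // f fL; have /LP[i [j ->]] := fL.
  (* The diagonal pairs belong to [L] but not to the arrangement; their functions are the constants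
     [- a i], nonzero by genericity. *)
  have [<-|ij] := eqVneq i j.
    rewrite subrr sub0r oppr_eq0;
      have := signed_sum_shift a_gen true (ltn_ord i)
      (isT : (i : nat) \notin [::]) (signed_sum0 a n.+1 [::]).
    by rewrite add0r.
  apply/eqP => /subr0_eq xij; apply: xA.
  by exists (Ghyperplane a i j); [exists i, j|split].
move=> [Dx xL]; split=> // -[_ [i [j [ij ->]]] [_ xij]].
have /xL : rod_gap a i j \o phi \in [seq g \o phi | g <- L].
  apply/mapP; exists (rod_gap a i j) => //; rewrite mem_cat; apply/orP; left.
  by apply/allpairsP; exists (i : nat, j : nat); split=> //;
    rewrite mem_iota; exact: ltn_ord.
by rewrite /= rodE xij subrr eqxx.
Qed.

End CountG.

Theorem theorem6p1 (R : realType) (a : nat -> R) (ha : generic a) :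
  [seq zseries a n * (n`!)%:R | n <- iota 0 7] =
    [seq m%:R | m <- [:: 1; 1; 3; 19; 195; 2831; 53703]%N] /\
  exists y : fps R,
    [/\ unique (fun u : fps R =>
          fps_const 1 =
          fps_mul u (fps_sub (fps_const 2) (fps_exp (fps_mul fps_X u)))) y,
        [seq y n * (n`!)%:R | n <- iota 0 6] =
          [seq m%:R | m <- [:: 1; 1; 5; 46; 631; 11586]%N]
      & unique (fun w : fps R =>
          fps_div (fps_deriv w) w = fps_pow y 2 /\ w 0%N = 1) (zseries a)].
Proof.
have fact_neq0 n : (n`!)%:R != 0 :> R by rewrite pnatr_eq0 -lt0n fact_gt0.
have zE n : zseries a n * (n`!)%:R = (rod_count true 0 n)%:R.
  by rewrite /zseries num_regions_GE // divfK.
split; first by rewrite -rod_count_z -map_comp; apply: eq_map => n;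
  rewrite /= zE.
have [y yE y_uniq] := fps_fixpoint (@tree_eq_contracting R).
have [w wE w_uniq] := fps_fixpoint (@deriv_eq_contracting R y).
exists y; split.
- by split=> [|u /tree_eqP/y_uniq]; [apply/tree_eqP|].
- rewrite -rod_count_y -map_comp; apply: eq_map => n /=.
  (* The recursion with [v = 1]; the value [b = false] reflects that y^0 = 1 has no higher
     coefficients. *)
  pose G k m := (1 * y ^+ k : fps R) m * (m`!)%:R.
  rewrite -(@rod_count_unique R false G) //; first by rewrite /G expr1 mul1r.
  + by rewrite /G expr0 mulr1 mulr1.
  + by move=> m; rewrite /G expr0 mulr1 [X in X * _](_ : _ = 0) ?mul0r.
  + by move=> k m; exact: tree_eq_recursion.
(* The numbers m! [x^m] (w y^k) satisfy both recursions of the cell counts, the equation w' = w y^2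
   giving the step from k = 0 to k = 2. *)
have -> : zseries a = w.
  apply/funext => n; apply: (mulIf (fact_neq0 n)); rewrite zE.
  pose G k m := (w * y ^+ k) m * (m`!)%:R.
  rewrite -(@rod_count_unique R true G) //; first by rewrite /G expr0 mulr1.
  + by rewrite /G expr0 mulr1 -wE /= mul1r.
  + by move=> m; rewrite /G expr0 mulr1 -{1}wE /= factS natrM mulrA divfK.
  + by move=> k m; exact: tree_eq_recursion.
by split=> [|u /deriv_eqP/w_uniq]; [apply/deriv_eqP|].
Qed.
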